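(* Let $K$ be a metric space and $f:K\to\mathbb{C}$ a bounded function. Then $f$ belongs to $B_{1/4}(K)$ if and only if $\operatorname{osc}_\omega f$ is a bounded function.
   Context: $D(K)$ is the set of all $f:K\to\mathbb{C}$ of the form $f=(\varphi_1-\varphi_2)+i(\varphi_3-\varphi_4)$ with $\varphi_1,\dots,\varphi_4$ bounded real-valued lower semi-continuous functions on $K$. Equivalently, $f\in D(K)$ iff there is a sequence $(\varphi_j)$ of continuous complex-valued functions on $K$ with $\sup_{k\in K}\sum_j|\varphi_j(k)|<\infty$ and $f=\sum_j\varphi_j$ pointwise; $\|f\|_D$ is the infimum of $\sup_{k\in K}\sum_j|\varphi_j(k)|$ over all such sequences. $B_{1/4}(K)$ is the set of all $f:K\to\mathbb{C}$ for which there exist $(f_n)$ in $D(K)$ and $\lambda<\infty$ with $f_n\to f$ uniformly and $\|f_n\|_D\le\lambda$ for all $n$. All $\limsup$'s are non-exclusive (the point itself is allowed). For $\varphi:K\to[-\infty,\infty]$, $U\varphi(x)=\limsup_{y\to x}\varphi(y)$. Transfinite oscillations: $\operatorname{osc}_0f\equiv0$. For an ordinal $\beta=\alpha+1$, $\widetilde{\operatorname{osc}}_\beta f(x)=\limsup_{y\to x}\bigl(|f(y)-f(x)|+\operatorname{osc}_\alpha f(y)\bigr)$; for a limit ordinal $\beta$, $\widetilde{\operatorname{osc}}_\beta f=\sup_{\alpha<\beta}\operatorname{osc}_\alpha f$; in both cases $\operatorname{osc}_\beta f=U\,\widetilde{\operatorname{osc}}_\beta f$. $\omega$ is the first infinite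 ordinal. *)

(* Defs.v *)
From HB Require Import structures.
From mathcomp Require Import all_boot all_order all_algebra.
From mathcomp Require Import all_classical all_reals all_analysis.
From mathcomp Require Export complex.
Set Implicit Arguments.
Unset Strict Implicit.
Unset Printing Implicit Defensive.
Import Order.TTheory GRing.Theory Num.Theory.
Import numFieldNormedType.Exports.
Local Open Scope classical_set_scope.
Local Open Scope ring_scope.

(* Complex-valued functions are typed K -> R[i]^o because MathComp-Analysis puts
   the topology of the numFieldType R[i] on the alias R[i]^o.  The norm `|z| of
   z : R[i] is itself an element of R[i]; Normc.normc z is the same modulus as an
   element of R. *)

Section Baire14.
Context {R : realType} {K : metricType R}.
Implicit Types f : K -> R[i]^o.

Definition bounded_lsc (phi : K -> R) : Prop :=
  bounded_fun phi /\ lower_semicontinuous (fun x => (phi x)%:E).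

Definition class_D f : Prop :=
  exists phi1 phi2 phi3 phi4 : K -> R,
    [/\ bounded_lsc phi1, bounded_lsc phi2, bounded_lsc phi3, bounded_lsc phi4
      & forall x, f x = ((phi1 x - phi2 x) +i* (phi3 x - phi4 x))%C].

Definition sup_sum_abs (phi : nat -> K -> R[i]^o) : \bar R :=
  ereal_sup (range (fun k =>
    (\sum_(0 <= j <oo) (Normc.normc (phi j k))%:E)%E)).

Definition D_series f (phi : nat -> K -> R[i]^o) : Prop :=
  [/\ forall j, continuous (phi j),
      (sup_sum_abs phi < +oo)%E
    & forall k, series (fun j => phi j k) @ \oo --> f k].

(* The infimum is taken in \bar R, so a function with no representing series
   has norm +oo. *)
Definition norm_D f : \bar R :=
  ereal_inf [set sup_sum_abs phi | phi in [set phi | D_series f phi]].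

Definition class_B14 f : Prop :=
  exists (fn : nat -> K -> R[i]^o) (lambda : R),
    (forall n, class_D (fn n) /\ (norm_D (fn n) <= lambda%:E)%E) /\
    {uniform, fn @ \oo --> f}.

(* nbhs x is the filter of full neighbourhoods, so this limsup is
   non-exclusive. *)
Definition upper_env (phi : K -> \bar R) (x : K) : \bar R :=
  limf_esup phi (nbhs x).

(* The oscillations of finite order and of order omega; the recursion defining
   osc_omega involves no other ordinals. *)
Fixpoint osc (n : nat) f : K -> \bar R :=
  match n with
  | 0%N => fun=> 0%E
  | m.+1 => upper_env (fun x =>
      limf_esup (fun y => ((Normc.normc (f y - f x))%:E + osc m f y)%E)
                (nbhs x))
  end.

Definition osc_omega f : K -> \bar R :=
  upper_env (fun x => ereal_sup (range (fun n => osc n f x))).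

Definition ebounded (phi : K -> \bar R) : Prop :=
  exists M : R, forall x, (`|phi x| <= M%:E)%E.

End Baire14.

(* Main.v *)
Require Import Defs.
From HB Require Import structures.
From mathcomp Require Import all_boot all_order all_algebra.
From mathcomp Require Import all_classical all_reals all_analysis.
From mathcomp Require Import lra.
Import Order.TTheory GRing.Theory Num.Theory.
Import numFieldNormedType.Exports.
Local Open Scope classical_set_scope.
Local Open Scope ring_scope.

(** Forward: if [g] is the sum of continuous [phi_j] and [F] that of the
    [|phi_j|], then [|g y - g x| <= F y - F x + o(1)] as [y -> x].  With [G] the
    upper envelope of [F], this yields [osc_m g <= G - F] for all finite [m], and
    a perturbation of [g] by [e] costs at most [2 m e], which can be made small
    for each fixed [m].

    Converse: if all [osc_k f] are bounded by [M], the average [W] of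
    [osc_0 f, ..., osc_n f] satisfies
    [|f y - f x| + W y <= W x + M / (n + 1) + o(1)] as [y -> x].  Hence (for real
    [f]) [f - W] and [- W] are lower semicontinuous up to the error
    [M / (n + 1)], and the difference of their lower envelopes approximates [f]
    uniformly, with a bound on the D-norm independent of [n]. *)

(** * The complex modulus as a real number, and convergence with real tolerances *)

Section Modulus.
Context {R : realType}.
Implicit Types z w : R[i].
Local Notation normc := Normc.normc.

Lemma normr_normc z : `|z| = (normc z)%:C%C.
Proof. by case: z. Qed.

Lemma normc_ge0 z : 0 <= normc z.
Proof. by rewrite -lecR -normr_normc normr_ge0. Qed.

Lemma normcD z w : normc (z + w) <= normc z + normc w.
Proof. by rewrite -lecR rmorphD /= -!normr_normc ler_normD. Qed.

Lemma normc_distC z w : normc (z - w) = normc (w - z).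
Proof. by apply: complexI; rewrite -!normr_normc distrC. Qed.

Lemma normc_dist_triangle u z w : normc (z - w) <= normc (z - u) + normc (u - w).
Proof. by rewrite (le_trans _ (normcD _ _))// addrA subrK. Qed.

Lemma normc_ge_abs_Re z : `|complex.Re z| <= normc z.
Proof. by rewrite -lecR -normr_normc normc_ge_Re. Qed.

Lemma normc_ge_abs_Im z : `|complex.Im z| <= normc z.
Proof.
case: z => a b /=; rewrite -sqrtr_sqr ler_sqrt; first by rewrite lerDr sqr_ge0.
by rewrite addr_ge0// sqr_ge0.
Qed.

Lemma normc_le_absD (a b : R) : normc (a +i* b)%C <= `|a| + `|b|.
Proof.
rewrite /= -[leRHS]ger0_norm ?addr_ge0// -sqrtr_sqr ler_sqrt ?sqr_ge0//.
rewrite sqrrD !real_normK ?num_real// -addrA lerD2l lerDr.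
by rewrite mulrn_wge0// mulr_ge0.
Qed.

(** Comparable complex numbers have equal imaginary parts, so the [R[i]]-valued tolerances in the
    topology of [R[i]^o] are real ones. *)
Lemma gt0_complexP (e : R[i]) : 0 < e -> exists2 r : R, 0 < r & e = r%:C%C.
Proof.
by case: e => a b; rewrite ltcE /= => /andP[/eqP -> a0]; exists a.
Qed.

Lemma cvg_normcP {T : Type} (F : set_system T) (FF : Filter F)
    (g : T -> R[i]^o) (l : R[i]^o) :
  g @ F --> l <->
  forall e : R, 0 < e -> \forall t \near F, normc (l - g t) < e.
Proof.
split=> [/cvgrPdist_lt gl e e0|gl].
  have e0C : 0 < e%:C%C :> R[i] by rewrite ltcR.
  by near do rewrite -ltcR -normr_normc; exact: gl.
apply/cvgrPdist_lt => _ /gt0_complexP[e e0 ->].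
near=> t; rewrite normr_normc ltcR; near: t; exact: gl.
Unshelve. all: by end_near. Qed.

Lemma cvg_complex {T : Type} (F : set_system T) (FF : Filter F)
    (a b : T -> R) (la lb : R) :
  a @ F --> la -> b @ F --> lb ->
  (fun t => (a t +i* b t)%C : R[i]^o) @ F --> ((la +i* lb)%C : R[i]^o).
Proof.
move=> /cvgrPdist_lt al /cvgrPdist_lt bl; apply/cvg_normcP => e e0.
have e20 : 0 < e / 2 by rewrite divr_gt0.
near=> t; apply: le_lt_trans (normc_le_absD _ _) _; rewrite (splitr e) ltrD//.
- by near: t; exact: al.
- by near: t; exact: bl.
Unshelve. all: by end_near. Qed.

Lemma bounded_normcP {T : Type} (f : T -> R[i]^o) :
  bounded_fun f -> exists C : R, forall x, normc (f x) <= C.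
Proof.
move=> [c [_ fc]]; exists (complex.Re (c + 1)) => x.
have := fc (c + 1); rewrite ltrDl ltr01 => /(_ isT x I).
by rewrite /= normr_normc lecE /= => /andP[].
Qed.

Lemma uniform_cvg_normcP {T : choiceType} (fn : nat -> T -> R[i]^o)
    (f : T -> R[i]^o) :
  {uniform, fn @ \oo --> f} <->
  forall e : R, 0 < e ->
    \forall n \near \oo, forall x, normc (f x - fn n x) < e.
Proof.
split=> [fnf e e0|H].
  apply: (fnf [set h : T -> R[i]^o | forall x, normc (f x - h x) < e]).
  apply/uniform_nbhs.
  exists [set xy : R[i]^o * R[i]^o | ball xy.1 (e%:C%C : R[i]) xy.2]; split.
    by rewrite -entourage_from_ballE; exists e%:C%C => //=; rewrite ltcR.
  move=> h /= fh x; have := fh x I.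
  by rewrite -ball_normE /ball_/= normr_normc ltcR.
move=> P /uniform_nbhs[E [+ EP]]; rewrite -entourage_from_ballE.
move=> [_ /= /gt0_complexP[e e0 ->] eE].
have := H e e0; apply: filterS => n fne.
by apply: EP => x _; apply: eE; rewrite /= -ball_normE /ball_/= normr_normc ltcR.
Qed.

End Modulus.

(** * Limits superior and upper envelopes *)

Section Limsup.
Context {R : realType} {T : topologicalType}.
Implicit Types (phi : T -> \bar R) (a : R) (x : T).

(** The sublevel set of height [a + d] is itself a competitor in the infimum defining
    [limf_esup]. *)
Lemma limf_esup_le (F : set_system T) phi a :
  (forall d, 0 < d -> \forall y \near F, (phi y <= (a + d)%:E)%E) ->
  (limf_esup phi F <= a%:E)%E.
Proof.
move=> H; apply/lee_addgt0Pr => d d0; apply: ge_ereal_inf.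
have Hd := H _ d0.
exists (ereal_sup [set phi y | y in [set y | (phi y <= (a + d)%:E)%E]]).
  by exists [set y | (phi y <= (a + d)%:E)%E].
by apply/ereal_supP => _ [y + <-].
Qed.

Lemma limf_esup_lt_near (F : set_system T) phi (u : \bar R) : Filter F ->
  (limf_esup phi F < u)%E -> \forall y \near F, (phi y < u)%E.
Proof.
move=> FF /ereal_inf_lt[_ [V FV <-] Vu]; apply: filterS FV => y Vy.
by apply: le_lt_trans Vu; apply: le_ereal_sup_tmp; exists (phi y) => //; exists y.
Qed.

Lemma limf_esup_nbhs_ge phi x : (phi x <= limf_esup phi (nbhs x))%E.
Proof.
apply/ereal_infP => _ [V Vx <-]; apply: le_ereal_sup_tmp; exists (phi x) => //.
by exists x => //; exact: nbhs_singleton.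
Qed.

(** [G] is the upper envelope of [F], finite because [F] is bounded. *)
Lemma usc_majorant (F : T -> R) (L : R) :
  (forall x, 0 <= F x <= L) ->
  exists G : T -> R, [/\ forall x, F x <= G x, forall x, G x <= L
    & forall x d, 0 < d -> \forall y \near x, G y <= G x + d].
Proof.
move=> FL; pose U x := limf_esup (EFin \o F) (nbhs x).
have UL x : (U x <= L%:E)%E.
  apply: limf_esup_le => d d0; apply: nearW => y /=.
  by rewrite lee_fin; have := FL y; lra.
have FU x : ((F x)%:E <= U x)%E := limf_esup_nbhs_ge (EFin \o F) x.
have UE x : ((fine (U x))%:E = U x)%E.
  by rewrite fineK// fin_numE -ltNye -ltey (lt_le_trans (ltNyr _) (FU x))
    (le_lt_trans (UL x) (ltry _)).
exists (fine \o U); split=> [x|x|x d d0]; rewrite /= -?lee_fin ?UE//.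
have : (U x < (fine (U x) + d)%:E)%E by rewrite -{1}UE lte_fin ltrDl.
(* The neighbourhood of [x] on which [F] stays below the constant may be taken open, so the bound
   passes to the envelope at each nearby [y]. *)
move=> /limf_esup_lt_near/nbhs_interior; apply: filterS => y.
rewrite /interior /= => Fy; rewrite -lee_fin UE; apply: limf_esup_le => e e0.
by apply: filterS Fy => z /= /ltW /le_trans -> //; rewrite lee_fin; lra.
Qed.

End Limsup.

(** * Oscillations of functions uniformly close to a sum of continuous functions *)

Section OscOfUniformLimit.
Context {R : realType} {K : metricType R}.
Implicit Types f g : K -> R[i]^o.
Local Notation normc := Normc.normc.

Lemma normc_sum_nat_le (u : nat -> R[i]) (m n : nat) :
  normc (\sum_(m <= j < n) u j) <= \sum_(m <= j < n) normc (u j).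
Proof.
apply: (big_ind2 (fun a b => normc a <= b)) => [|a a' b b' ? ?|//].
  by rewrite Normc.normc0.
by rewrite (le_trans (normcD _ _))// lerD.
Qed.

(** [F] is the pointwise sum of the moduli. The tail of [g] is dominated by the tail of [F], and the
    remaining finite sum is continuous. *)
Lemma D_series_majorant g (phi : nat -> K -> R[i]^o) (L : R) :
  D_series g phi -> (sup_sum_abs phi <= L%:E)%E ->
  exists F : K -> R, (forall x, 0 <= F x <= L) /\
    forall x d, 0 < d ->
      \forall y \near x, normc (g y - g x) <= F y - F x + d.
Proof.
move=> [phic _ phig] supL.
pose A n x := \sum_(0 <= j < n) normc (phi j x).
pose S n x := \sum_(0 <= j < n) phi j x.
have AL n x : A n x <= L.
  rewrite -lee_fin; apply: le_trans supL; apply: le_ereal_sup_tmp.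
  exists (\sum_(0 <= j <oo) (normc (phi j x))%:E)%E; first by exists x.
  by rewrite /A -sumEFin; apply: nneseries_lim_ge => j _ _; rewrite lee_fin normc_ge0.
have A_mono x : {homo A ^~ x : m n / (m <= n)%N >-> m <= n}.
  move=> m n mn; rewrite /A (big_cat_nat (leq0n m) mn)//= lerDl.
  by apply: sumr_ge0 => j _; exact: normc_ge0.
have A_bnd x : has_ubound (range (A ^~ x)) by exists L => _ [n _ <-].
pose F x := sup (range (A ^~ x)).
have AF n x : A n x <= F x by apply: ub_le_sup => //; exists n.
have FL x : F x <= L.
  by apply: ge_sup => [|_ [n _ <-]//]; exists (A 0%N x), 0%N.
have Sc n : continuous (S n : K -> R[i]^o).
  move=> x; rewrite /S; elim: n => [|n IH].
    under eq_fun do rewrite big_geq//; exact: cvg_cst.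
  under eq_fun do rewrite big_nat_recr//=.
  by apply: cvgD => //; exact: phic.
have Ac n x : forall d, 0 < d -> \forall y \near x, A n x - d < A n y.
  elim: n => [|n IH] d d0.
    by apply: nearW => y; rewrite /A !big_geq//; lra.
  have d20 : 0 < d / 2 by rewrite divr_gt0.
  have /cvg_normcP/(_ _ d20) := phic n x.
  apply: filterS2 (IH _ d20) => y Ay phiy; rewrite /A !big_nat_recr//= -!/(A n _).
  have := normcD (phi n x - phi n y) (phi n y); rewrite subrK; lra.
have gS n x : normc (g x - S n x) <= F x - A n x.
  apply/ler_addgt0Pr => e e0.
  have /cvg_normcP/(_ e e0)[N _ HN] := phig x.
  have {HN} := HN (maxn N n) (leq_maxl _ _).
  rewrite /= /series /= -/(S _ x) => gSn.
  have nN := leq_maxr N n.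
  have : normc (S (maxn N n) x - S n x) <= A (maxn N n) x - A n x.
    rewrite /S /A !(big_cat_nat (leq0n n) nN)//= [in leLHS]addrAC subrr add0r.
    by rewrite [leRHS]addrAC subrr add0r normc_sum_nat_le.
  have := normc_dist_triangle (S (maxn N n) x) (g x) (S n x).
  by have := AF (maxn N n) x; lra.
exists F; split=> [x|x d d0].
  by rewrite FL andbT (le_trans _ (AF 0%N x))// /A big_geq.
(* Four errors occur: the drop of [A n], the variation of [S n], and [F x - A n x] twice, once for
   the tail at [x] and once to replace [A n x] by [F x]. *)
have d40 : 0 < d / 4 by rewrite divr_gt0.
have [_ [n _ <-]] : exists2 a, range (A ^~ x) a & F x - d / 4 < a.
  by apply: sup_adherent => //; split=> //; exists (A 0%N x), 0%N.
move=> FAx.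
have /cvg_normcP/(_ _ d40) := Sc n x.
apply: filterS2 (Ac n x _ d40) => y Ay Sy.
have := gS n x; have := gS n y.
have := normc_dist_triangle (S n y) (g y) (g x).
have := normc_dist_triangle (S n x) (S n y) (g x).
by rewrite (normc_distC (S n y) (S n x)) (normc_distC (S n x) (g x)); lra.
Qed.

(* Since [F] is lower and [G] upper semicontinuous, [G - F] is its own upper
   envelope, so the induction on the order of the oscillation closes up. *)
Lemma osc_le f g (F G : K -> R) (e : R) : 0 <= e ->
  (forall x, normc (f x - g x) <= e) ->
  (forall x d, 0 < d ->
    \forall y \near x, normc (g y - g x) <= F y - F x + d) ->
  (forall x, F x <= G x) ->
  (forall x d, 0 < d -> \forall y \near x, G y <= G x + d) ->
  forall m x, (osc m f x <= (G x - F x + m%:R * (2 * e))%:E)%E.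
Proof.
move=> e0 fg gF FG Gusc; elim=> [|m IH] x /=.
  by rewrite mul0r addr0 lee_fin subr_ge0.
apply: limf_esup_le => d d0.
have d20 : 0 < d / 2 by rewrite divr_gt0.
(* This outer limsup is the upper envelope; as moduli are nonnegative, [gF] also bounds [F z] from
   below by [F x - d / 2]. *)
apply: filterS2 (gF x _ d20) (Gusc x _ d20) => z Fz Gz.
apply: (@le_trans _ _ (G z - F z + m.+1%:R * (2 * e))%:E); last first.
  by rewrite lee_fin; have := normc_ge0 (g z - g x); lra.
apply: limf_esup_le => c c0.
have c20 : 0 < c / 2 by rewrite divr_gt0.
(* The [F y] from [gF] cancels the [- F y] from the induction hypothesis, leaving [G z - F z].
   Replacing [f] by [g] at [y] and at [z] costs [2 * e]. *)
apply: filterS2 (gF z _ c20) (Gusc z _ c20) => y Fy Gy.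
apply: le_trans (leeD2l _ (IH y)) _.
rewrite -EFinD lee_fin -natr1.
have := normc_dist_triangle (g y) (f y) (f z).
have := normc_dist_triangle (g z) (g y) (f z).
by have := fg y; have := fg z; rewrite (normc_distC (f z)); lra.
Qed.

End OscOfUniformLimit.

(** * Lower semicontinuous minorants as sums of continuous functions *)

Section SemicontinuousApproximation.
Context {R : realType} {K : metricType R}.
Local Notation normc := Normc.normc.

(* The inf-convolutions [x |-> inf_y (phi y + n d(x, y))]. *)
Lemma lipschitz_minorants (phi : K -> R) (B e : R) :
  (forall x, `|phi x| <= B) ->
  (forall x d, 0 < d -> \forall y \near x, phi x - e - d <= phi y) ->
  exists h : nat -> K -> R,
    [/\ forall n, continuous (h n),
        forall x, {homo h ^~ x : m n / (m <= n)%N >-> m <= n},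
        forall n x, - B <= h n x <= phi x
      & forall x d, 0 < d -> exists n, phi x - e - d <= h n x].
Proof.
move=> phiB phi_e.
pose E n x := range (fun y => phi y + n%:R * mdist x y).
pose h n x := inf (E n x).
have phi_ge y : - B <= phi y by have := phiB y; rewrite ler_norml => /andP[].
have phi_le y : phi y <= B by have := phiB y; rewrite ler_norml => /andP[].
have nd_ge0 n (x y : K) : 0 <= n%:R * mdist x y by rewrite mulr_ge0// mdist_ge0.
have h_le n x y : h n x <= phi y + n%:R * mdist x y.
  apply: ge_inf; last by exists y.
  by exists (- B) => _ [z _ <-]; have := phi_ge z; have := nd_ge0 n x z; lra.
have h_ge n x a : (forall y, a <= phi y + n%:R * mdist x y) -> a <= h n x.
  move=> H; apply: lb_le_inf => [|_ [y _ <-]//].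
  by exists (phi x + n%:R * mdist x x), x.
exists h; split.
- move=> n x; apply/cvgrPdist_lt => d d0.
  have n10 : 0 < n%:R + 1 :> R by rewrite ltr_wpDl.
  have dn0 : 0 < d / (n%:R + 1) by rewrite divr_gt0.
  have h_lip z y : h n z <= h n y + n%:R * mdist z y.
    rewrite -lerBlDr; apply: h_ge => w; have := h_le n z w.
    have : n%:R * mdist z w <= n%:R * mdist z y + n%:R * mdist y w.
      by rewrite -mulrDr ler_wpM2l// metric_triangle.
    lra.
  have := nbhsx_ballx x _ dn0; apply: filterS => y.
  rewrite ballEmdist /= ltr_pdivlMr// mulrDr mulr1 mulrC => xy.
  have := h_lip x y; have := h_lip y x; rewrite (metric_sym y x).
  by have := mdist_ge0 x y; rewrite ltr_norml; lra.
- move=> x m n mn; apply: h_ge => y; apply: le_trans (h_le m x y) _.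
  by rewrite lerD2l ler_wpM2r ?mdist_ge0// ler_nat.
- move=> n x; apply/andP; split.
    by apply: h_ge => y; have := phi_ge y; have := nd_ge0 n x y; lra.
  by have := h_le n x x; rewrite mdistxx mulr0 addr0.
- move=> x d d0; have /nbhs_ballP[r /= r0 Hr] := phi_e x d d0.
  (* This makes [n.+1 * r] exceed [2 B + |e|], so a point at distance at least [r] gives a value
     above [B + |e|], hence above [phi x - e]. *)
  pose n := Num.trunc ((B + B + `|e|) / r).
  exists n.+1; apply: h_ge => y.
  have [xy|xy] := ltP (mdist x y) r.
    have := Hr y; rewrite ballEmdist => /(_ xy).
    by have := nd_ge0 n.+1 x y; lra.
  have := truncnS_gt ((B + B + `|e|) / r); rewrite ltr_pdivrMr// => Br.
  have : n.+1%:R * r <= n.+1%:R * mdist x y by rewrite ler_wpM2l.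
  by have := phi_le x; have := phi_ge y; have := ler_norm (- e); rewrite normrN; lra.
Qed.

(** The supremum [u] of the increasing continuous minorants is lower semicontinuous, and their
    successive differences form a series with sum [u]. *)
Lemma bounded_lsc_approx (phi : K -> R) (B e : R) :
  (forall x, `|phi x| <= B) ->
  (forall x d, 0 < d -> \forall y \near x, phi x - e - d <= phi y) ->
  exists (u : K -> R) (s : nat -> K -> R),
    [/\ bounded_lsc u, forall x, phi x - e <= u x <= phi x,
        forall j, continuous (s j),
        forall x n, \sum_(0 <= j < n) `|s j x| <= 3 * B
      & forall x, series (s ^~ x) @ \oo --> u x].
Proof.
move=> phiB phi_e.
have [h [hc h_mono h_bnd h_e]] := lipschitz_minorants _ _ _ phiB phi_e.
have phi_le y : phi y <= B by have := phiB y; rewrite ler_norml => /andP[].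
pose u x := sup (range (h ^~ x)).
have h_ub x : has_ubound (range (h ^~ x)).
  by exists (phi x) => _ [n _ <-]; have /andP[] := h_bnd n x.
have hu n x : h n x <= u x by apply: ub_le_sup => //; exists n.
have u_le x a : (forall n, h n x <= a) -> u x <= a.
  by move=> H; apply: ge_sup => [|_ [n _ <-]//]; exists (h 0%N x), 0%N.
have u_phi x : u x <= phi x by apply: u_le => n; have /andP[] := h_bnd n x.
pose s j x := if j is i.+1 then h i.+1 x - h i x else h 0%N x.
have s_sum n x : series (s ^~ x) n.+1 = h n x.
  elim: n => [|n IH]; first by rewrite seriesEnat /= big_nat1.
  by rewrite seriesSr IH /= addrC subrK.
exists u, s; split.
- split.
    exists B; split; first exact: num_real.
    move=> b Bb x _ /=; rewrite (le_trans _ (ltW Bb))// ler_norml.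
    by have := hu 0%N x; have := h_bnd 0%N x; have := u_phi x; have := phi_le x; lra.
  move=> x a; rewrite lte_fin => /sup_gt[]; first by exists (h 0%N x), 0%N.
  move=> _ [n _ <-] ahx; exists [set y | a < h n y].
    have /cvgrPdist_lt/(_ (h n x - a)) := hc n x; rewrite subr_gt0 => /(_ ahx).
    by apply: filterS => y; rewrite ltr_norml /=; lra.
  by move=> y /= ahy; rewrite lte_fin (lt_le_trans ahy).
- move=> x; rewrite u_phi andbT; apply/ler_addgt0Pr => d d0.
  by have [n] := h_e x d d0; have := hu n x; lra.
- case=> [|j] x; first exact: hc.
  by apply: cvgB; exact: hc.
- move=> x n.
  have B0 : 0 <= B by apply: le_trans (phiB x).
  (* All terms after the first are nonnegative and telescope: [B] for the first and at most [2 * B]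
     for the rest give [3 * B]. *)
  have S_le m : \sum_(0 <= j < m.+1) `|s j x| <= B + (h m x - h 0%N x).
    elim: m => [|m IH].
      rewrite big_nat1 /= subrr addr0 ler_norml.
      by have := h_bnd 0%N x; have := phi_le x; lra.
    rewrite big_nat_recr//= ger0_norm; first by lra.
    by rewrite subr_ge0 h_mono.
  case: n => [|n]; first by rewrite big_geq// mulr_ge0.
  by have := S_le n; have := h_bnd n x; have := h_bnd 0%N x; have := phi_le x; lra.
- move=> x; rewrite -cvg_shiftS /=; under eq_fun do rewrite s_sum.
  by apply: nondecreasing_cvgn => //; exact: h_mono.
Qed.

End SemicontinuousApproximation.

(** * Approximation by members of [D] when the finite oscillations are bounded *)

Section Approximation.
Context {R : realType} {K : metricType R}.
Implicit Types f g : K -> R[i]^o.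
Local Notation normc := Normc.normc.

(* Up to [e], the functions [Re f - W], [Im f - W] and [- W] are lower
   semicontinuous, and [g] combines their lower semicontinuous minorants. *)
Lemma D_approx f (W : K -> R) (C M e : R) :
  (forall x, normc (f x) <= C) -> (forall x, `|W x| <= M) ->
  (forall x d, 0 < d ->
    \forall y \near x, normc (f y - f x) + W y <= W x + e + d) ->
  exists g, [/\ class_D g, (norm_D g <= (12 * (C + M))%:E)%E
    & forall x, normc (f x - g x) <= 2 * e].
Proof.
move=> fC WM fW.
have ReB x : `|complex.Re (f x) - W x| <= C + M.
  by rewrite (le_trans (ler_normB _ _))// lerD// (le_trans (normc_ge_abs_Re _)).
have ImB x : `|complex.Im (f x) - W x| <= C + M.
  by rewrite (le_trans (ler_normB _ _))// lerD// (le_trans (normc_ge_abs_Im _)).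
have WB x : `|- W x| <= C + M.
  by rewrite normrN (le_trans (WM x))// lerDr (le_trans (normc_ge0 (f x))).
have [x d d0|u1 [s1 [u1_lsc u1W s1c s1B s1u]]] := bounded_lsc_approx _ _ e ReB.
  apply: filterS (fW x d d0) => y.
  (* The real part drops by at most [normc (f y - f x)], which [fW] bounds by
     [W x - W y + e + d]. *)
  have := normc_ge_abs_Re (f y - f x); rewrite raddfB /= ler_norml; lra.
have [x d d0|u2 [s2 [u2_lsc u2W s2c s2B s2u]]] := bounded_lsc_approx _ _ e ImB.
  apply: filterS (fW x d d0) => y.
  have := normc_ge_abs_Im (f y - f x); rewrite raddfB /= ler_norml; lra.
have [x d d0|v [t [v_lsc vW tc tB tv]]] := bounded_lsc_approx _ _ e WB.
  by apply: filterS (fW x d d0) => y; have := normc_ge0 (f y - f x); lra.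
pose g x := ((u1 x - v x) +i* (u2 x - v x))%C : R[i]^o.
pose phi j x := ((s1 j x - t j x) +i* (s2 j x - t j x))%C : R[i]^o.
have phiE n x : series (phi ^~ x) n =
    ((series (s1 ^~ x) n - series (t ^~ x) n) +i*
     (series (s2 ^~ x) n - series (t ^~ x) n))%C.
  elim: n => [|n IH]; first by rewrite !seriesEnat /= !big_geq// subrr.
  by rewrite !seriesSr IH /phi; simpc; congr (_ +i* _)%C; lra.
have supphi : (sup_sum_abs phi <= (12 * (C + M))%:E)%E.
  apply/ereal_supP => _ [x _ <-]; apply: lime_le.
    by apply: is_cvg_nneseries => n _ _; rewrite lee_fin normc_ge0.
  apply: nearW => n; rewrite sumEFin lee_fin.
  (* The series [t] serves both the real and the imaginary part, so four sums of size [3 * (C + M)]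
     yield the factor [12]. *)
  have : \sum_(0 <= j < n) normc (phi j x) <=
      \sum_(0 <= j < n) (`|s1 j x| + `|s2 j x| + `|t j x| + `|t j x|).
    apply: ler_sum => j _; apply: le_trans (normc_le_absD _ _) _.
    by have := ler_normB (s1 j x) (t j x); have := ler_normB (s2 j x) (t j x); lra.
  rewrite !big_split /=.
  by have := s1B x n; have := s2B x n; have := tB x n; lra.
exists g; split.
- by exists u1, v, u2, v.
- apply: ge_ereal_inf; exists (sup_sum_abs phi) => //; exists phi => //; split.
  + move=> j x; apply: cvg_complex; apply: cvgB; first [exact: s1c|exact: s2c|exact: tc].
  + exact: le_lt_trans supphi (ltry _).
  + by move=> x; rewrite (funext (phiE ^~ x)); apply: cvg_complex; exact: cvgB.
- move=> x.
  have -> : f x - g x = ((complex.Re (f x) - (u1 x - v x)) +i*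
      (complex.Im (f x) - (u2 x - v x)))%C by rewrite /g; case: (f x).
  rewrite (le_trans (normc_le_absD _ _))// mulr_natl mulr2n.
  (* Each minorant lies below its target by an amount in [[0, e]], so each of the two differences is
     off by at most [e]. *)
  have := u1W x; have := u2W x; have := vW x => /andP[? ?] /andP[? ?] /andP[? ?].
  by rewrite lerD// ler_norml; apply/andP; split; lra.
Qed.

Lemma osc_ge0 n f x : (0 <= osc n f x)%E.
Proof.
elim: n x => [//|n IH] x; apply: limf_esup_ge0 => [|z].
  exact: (filter_not_empty (nbhs x)).
apply: limf_esup_ge0 => [|y]; first exact: (filter_not_empty (nbhs z)).
by rewrite adde_ge0// lee_fin normc_ge0.
Qed.

(** The envelope dominates the inner limsup at [x], and a limsup below [r] keeps the function below
    [r] nearby. *)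
Lemma osc_step (n : nat) f (r : R) x :
  (osc n.+1 f x < r%:E)%E ->
  \forall y \near x, ((normc (f y - f x))%:E + osc n f y < r%:E)%E.
Proof.
move=> /(le_lt_trans (limf_esup_nbhs_ge _ _)).
exact: limf_esup_lt_near.
Qed.

(* For the average of [osc 0 f, ..., osc n f], the defects
   [osc k.+1 f - osc k f] telescope to [osc n.+1 f / n.+1 <= M / n.+1]. *)
Lemma osc_mean f (M : R) (n : nat) :
  (forall k x, (osc k f x <= M%:E)%E) ->
  exists W : K -> R, (forall x, `|W x| <= M) /\
    forall x d, 0 < d -> \forall y \near x,
      normc (f y - f x) + W y <= W x + M / n.+1%:R + d.
Proof.
move=> oscM; pose o k x := fine (osc k f x).
have oE k x : (o k x)%:E = osc k f x.
  by rewrite fineK// fin_numE -ltNye -ltey (lt_le_trans (ltNyr 0) (osc_ge0 k f x))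
    (le_lt_trans (oscM k x) (ltry _)).
have o_ge0 k x : 0 <= o k x by rewrite -lee_fin oE osc_ge0.
have oM k x : o k x <= M by rewrite -lee_fin oE.
pose S m x := \sum_(0 <= k < m) o k x.
have S_ge0 m x : 0 <= S m x by apply: sumr_ge0.
have SM m x : S m x <= m%:R * M.
  rewrite /S; elim: m => [|m IH]; first by rewrite big_geq// mul0r.
  by rewrite big_nat_recr//= -natr1; have := oM m x; lra.
(* This sums [osc_step] over the orders [k < m]: the shifted sum of the [o k.+1 x] is
   [S m x + o m x], since [o 0 x] vanishes. *)
have step m x d : 0 < d -> \forall y \near x,
    m%:R * normc (f y - f x) + S m y <= S m x + o m x + m%:R * d.
  move=> d0; elim: m => [|m IH].
    by apply: nearW => y; rewrite /S !big_geq//; have := o_ge0 0%N x; lra.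
  have : (osc m.+1 f x < (o m.+1 x + d)%:E)%E by rewrite -oE lte_fin ltrDl.
  move=> /osc_step; apply: filterS2 IH => y.
  rewrite -oE -EFinD lte_fin /S !big_nat_recr//= -natr1; lra.
have n0 : 0 < n.+1%:R :> R by rewrite ltr0n.
exists (fun x => S n.+1 x / n.+1%:R); split=> [x|x d d0].
  by rewrite ger0_norm ?divr_ge0// ler_pdivrMr// mulrC.
apply: filterS (step n.+1 x d d0) => y Sy.
rewrite -(ler_pM2l n0) !mulrDr !(mulrC _ (_ / _)) !divfK ?gt_eqF//.
by have := oM n.+1 x; lra.
Qed.

Lemma osc_le_omega n f x : (osc n f x <= osc_omega f x)%E.
Proof.
apply: le_trans (limf_esup_nbhs_ge _ _).
by apply: le_ereal_sup_tmp; exists (osc n f x) => //; exists n.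
Qed.

Lemma osc_omega_le f (L : R) :
  (forall n x, (osc n f x <= L%:E)%E) -> forall x, (osc_omega f x <= L%:E)%E.
Proof.
move=> H x; apply: limf_esup_le => d d0; apply: nearW => y.
by apply/ereal_supP => _ [n _ <-]; rewrite (le_trans (H n y))// lee_fin lerDl ltW.
Qed.

End Approximation.

Theorem corollary4 (R : realType) (K : metricType R) (f : K -> R[i]^o)
  (hf : bounded_fun f) : class_B14 f <-> ebounded (osc_omega f).
Proof.
split=> [[fn [l [fn_D /uniform_cvg_normcP fn_f]]]|[M fM]].
  exists (l + 1) => x.
  rewrite gee0_abs; last exact: le_trans (osc_ge0 0 f x) (osc_le_omega 0 f x).
  apply: osc_omega_le => m {}x; apply/lee_addgt0Pr => d d0.
  (* The tolerance depends on the order [m], so that the perturbation cost [m * (2 * e)] is at most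
     [d]; [m.+1] avoids dividing by zero. *)
  pose e : R := d / (m.+1%:R * 2).
  have e0 : 0 < e by rewrite divr_gt0// mulr_gt0.
  have [N _ /(_ N (leqnn N)) fN] := fn_f e e0.
  have [_ fNl] := fn_D N.
  (* The infimum [norm_D] need not be attained; the slack [1] provides an actual series. *)
  have : (norm_D (fn N) < (l + 1)%:E)%E.
    by rewrite (le_lt_trans fNl)// lte_fin ltrDl.
  move=> /ereal_inf_lt[_ [phi phi_fN <-] /ltW phil].
  have [F [Fl fNF]] := D_series_majorant _ _ _ phi_fN phil.
  have [G [FG Gl Gusc]] := usc_majorant _ _ Fl.
  have fNe y : Normc.normc (f y - fn N y) <= e by exact/ltW/fN.
  apply: le_trans (osc_le _ _ _ _ _ (ltW e0) fNe fNF FG Gusc m x) _.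
  have ed : m.+1%:R * (2 * e) = d.
    by rewrite /e mulrA mulrC divfK// gt_eqF// mulr_gt0.
  rewrite -EFinD lee_fin; have /andP[F0 _] := Fl x; have Gx := Gl x.
  by move: ed; rewrite -natr1; lra.
have [C fC] := bounded_normcP _ hf.
have oscM k x : (osc k f x <= M%:E)%E.
  exact: le_trans (osc_le_omega k f x) (le_trans (lee_abs _) (fM x)).
have approx n : exists g : K -> R[i]^o,
    [/\ class_D g, (norm_D g <= (12 * (C + M))%:E)%E
      & forall x, Normc.normc (f x - g x) <= 2 * (M / n.+1%:R)].
  have [W [WM fW]] := osc_mean f M n oscM.
  exact: D_approx fC WM fW.
have [fn fnP] := choice approx.
exists fn, (12 * (C + M)); split; first by move=> n; have [] := fnP n.
apply/uniform_cvg_normcP => e e0.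
exists (Num.trunc (2 * M / e)) => // n /= en x.
have [_ _ /(_ x) /le_lt_trans] := fnP n; apply.
rewrite mulrA ltr_pdivrMr// (mulrC e) -ltr_pdivrMr//.
by rewrite (lt_le_trans (truncnS_gt _))// ler_nat.
Qed.
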